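(* For every real $k\ge0$ and every $x\in\mathbb{R}^n$, the function $\mathbb{R}^n\to(0,\infty)$, $s\mapsto F_{k,s}(x)$, is log-convex and Schur-convex.
   Context: Let $\rho=\frac12\sum_{1\le i<j\le n}(e_i-e_j)$, with $e_i$ the standard basis of $\mathbb{R}^n$. For $\xi\in\mathbb{R}^n$ and $k\ge0$ the Cherednik operator acts on $f\in C^1(\mathbb{R}^n)$ by $T_{k,\xi}f(x)=\partial_\xi f(x)+k\sum_{1\le i<j\le n}\frac{\xi_i-\xi_j}{1-e^{-(x_i-x_j)}}\big[f(x)-f(s_{ij}x)\big]-k\langle\rho,\xi\rangle f(x)$, where $s_{ij}$ transposes the coordinates $x_i,x_j$. For $s\in\mathbb{R}^n$, $G_{k,s}$ is the unique smooth function on $\mathbb{R}^n$ with $T_{k,\xi}G_{k,s}=\langle s,\xi\rangle G_{k,s}$ for all $\xi\in\mathbb{R}^n$ and $G_{k,s}(0)=1$, and the (type $A$) Heckman–Opdam hypergeometric function is $F_{k,s}(x)=\frac1{n!}\sum_{\sigma\in S_n}G_{k,s}(\sigma(x))$. A function $f:\mathbb{R}^n\to[0,\infty)$ is log-convex if $\log f$ is convex. For $x\in\mathbb{R}^n$ let $x^+$ be its decreasing rearrangement; $x$ majorizes $y$ if $\sum_ix_i=\sum_iy_i$ and $\sum_{i\le r}x^+_i\ge\sum_{i\le r}y^+_i$ for $1\le r<n$; $f$ is Schur-convex if $f(x)\ge f(y)$ whenever $x$ majorizes $y$. *)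

(* Defs.v *)
From HB Require Import structures.
From mathcomp Require Import all_boot all_order all_algebra all_fingroup.
From mathcomp Require Import all_classical all_reals all_analysis.

Set Implicit Arguments.
Unset Strict Implicit.
Unset Printing Implicit Defensive.

Import Order.TTheory GRing.Theory Num.Theory.
Import numFieldNormedType.Exports.

Local Open Scope classical_set_scope.
Local Open Scope ring_scope.

Definition dotp (R : realType) (n : nat) (u v : 'rV[R]_n) : R :=
  \sum_(i < n) u ord0 i * v ord0 i.

Definition basis_vec (R : realType) (n : nat) (i : 'I_n) : 'rV[R]_n :=
  delta_mx ord0 i.

Definition rho (R : realType) (n : nat) : 'rV[R]_n :=
  2^-1 *: \sum_(i < n) \sum_(j < n | (i < j)%N)
            (basis_vec R i - basis_vec R j).

Fixpoint Cn (R : realType) (n m : nat) (f : 'rV[R]_n -> R) : Prop :=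
  match m with
  | 0 => continuous f
  | m'.+1 => (forall x, differentiable f x) /\
             (forall v, Cn m' (fun x => 'D_v f x))
  end.

Definition smooth (R : realType) (n : nat) (f : 'rV[R]_n -> R) : Prop :=
  forall m, Cn m f.

(* The difference quotient (f(x) - f(s_ij x)) / (1 - e^{-(x_i - x_j)}), where
   [xcol i j] is s_ij.  On the hyperplane x_i = x_j, where it reads 0/0, it is
   given its limit value, the derivative of f along e_i - e_j: this is the
   continuous extension of the quotient when f is C^1. *)
Definition cherednik_quot (R : realType) (n : nat) (i j : 'I_n)
    (f : 'rV[R]_n -> R) (x : 'rV[R]_n) : R :=
  if x ord0 i == x ord0 j then 'D_(basis_vec R i - basis_vec R j) f x
  else (f x - f (xcol i j x)) / (1 - expR (- (x ord0 i - x ord0 j))).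

Definition cherednik (R : realType) (n : nat) (k : R) (xi : 'rV[R]_n)
    (f : 'rV[R]_n -> R) (x : 'rV[R]_n) : R :=
  'D_xi f x
  + k * (\sum_(i < n) \sum_(j < n | (i < j)%N)
           (xi ord0 i - xi ord0 j) * cherednik_quot i j f x)
  - k * dotp (rho R n) xi * f x.

(* The properties characterizing G_{k,s}; for k >= 0 there is exactly one
   such g (Opdam). *)
Definition is_opdam_G (R : realType) (n : nat) (k : R) (s : 'rV[R]_n)
    (g : 'rV[R]_n -> R) : Prop :=
  [/\ smooth g,
      forall xi x, cherednik k xi g x = dotp s xi * g x
    & g 0 = 1].

Definition symmetrize (R : realType) (n : nat)
    (g : 'rV[R]_n -> R) (x : 'rV[R]_n) : R :=
  (n`!)%:R^-1 * \sum_(sigma : 'S_n) g (col_perm sigma x).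

(* For positive f only: the library's [ln] is 0 on nonpositive reals. *)
Definition log_convex (R : realType) (n : nat) (f : 'rV[R]_n -> R) : Prop :=
  (forall s, 0 < f s) /\
  convex_function [set: convex_lmodType 'rV[R]_n] (fun s => ln (f s)).

Definition decr (R : realType) (n : nat) (x : 'rV[R]_n) : 'rV[R]_n :=
  \row_(i < n) nth 0 (sort >=%R [seq x ord0 j | j <- enum 'I_n]) i.

Definition majorizes (R : realType) (n : nat) (x y : 'rV[R]_n) : Prop :=
  \sum_(i < n) x ord0 i = \sum_(i < n) y ord0 i /\
  forall r : nat, (1 <= r < n)%N ->
    \sum_(i < n | (i < r)%N) decr y ord0 i
      <= \sum_(i < n | (i < r)%N) decr x ord0 i.

Definition schur_convex (R : realType) (n : nat) (f : 'rV[R]_n -> R) : Prop :=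
  forall x y, majorizes x y -> f y <= f x.

(* Main.v *)
(** Fix [x] and put [u_sigma(t) = G_{k,s}(t sigma x)] for [sigma] in [S_n].  The
    Cherednik equations in the directions [sigma x] at [t sigma x] form a closed
    linear system in [t]
      [u_sigma' = V_sigma u_sigma
                  + k sum_(i < j) r_ij (u_(s_ij sigma) - u_sigma)]
    with [V_sigma] affine in [s] and rates [r_ij = b / (1 - exp (- t b)) >= 0],
    where [b = (sigma x)_i - (sigma x)_j].  A minimum principle holds for such
    systems despite the singularity at [t = 0]; it gives positivity, uniqueness,
    and, since a weighted geometric mean of two solutions is a supersolution,
    log-convexity of [G_{k,s}(x)] in [s].  Hoelder's inequality passes this to
    [F_{k,s}].  For [tau] the transposition of [i] and [i+1], and
    [c = k / (s_i - s_(i+1))], the function [G_{k,s} o tau + c G_{k,s}] solves the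
    system for [tau s], whence [F_{k,tau s} = F_{k,s}] by uniqueness.  A symmetric
    quasiconvex function is Schur-convex. *)

Require Import Defs.
From mathcomp Require Import all_boot all_order all_algebra all_fingroup.
From mathcomp Require Import all_classical all_reals all_analysis.
From mathcomp Require Import ring lra zify.
Import Order.TTheory GRing.Theory Num.Theory.
Import numFieldNormedType.Exports.
Local Open Scope classical_set_scope.
Local Open Scope ring_scope.

(** * Linear systems with jump terms *)

(** Difference quotients from the left are nonpositive at [c]. One side suffices, so [c] may be the
    right endpoint of an interval. *)
Lemma le0_derive_left_min (R : realType) (f : R -> R) (a c df : R) :
  a < c -> is_derive c 1 f df -> (forall t, a <= t <= c -> f c <= f t) ->
  df <= 0.
Proof.
move=> ac [dfc <-] cmin.
rewrite ['D_1 f c]cvg_at_leftE; last exact: dfc.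
apply: limr_le.
  rewrite -(cvg_at_leftE (fun h => h^-1 *: ((f \o shift c) _ - f c))) //.
  apply: cvg_trans dfc; apply: cvg_app.
  move=> A [e egt0 Ae]; exists e => // x xe xgt0; apply: Ae => //.
  exact/ltr0_neq0.
near=> h.
have h0 : h < 0 by near: h; exists 1 => /=.
apply: mulr_le0_ge0; first by rewrite invr_le0 ltW.
rewrite subr_ge0 [_%:A]mulr1; apply: cmin; rewrite /= gerDr (ltW h0) andbT.
near: h; exists (c - a); first by rewrite /= subr_gt0.
move=> h; rewrite /= distrC subr0 => /ltr_normlP [hc _] _.
by rewrite addrC -lerBlDl -opprB lerNl ltW.
Unshelve. all: by end_near. Qed.

(** The generator of a Markov chain that jumps from [i] to [act p i] at rate [r p i t], plus a
    potential. *)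
Definition jump_field (R : realType) (I J : finType) (act : J -> I -> I)
    (V : I -> R) (r : J -> I -> R -> R) (u : I -> R -> R) (i : I) (t : R) : R :=
  V i * u i t + \sum_(p : J) r p i t * (u (act p i) t - u i t).

(* The rates may blow up at [t = 0]: at a negative minimum the jump terms are
   nonnegative whatever their size. *)
Lemma jump_minimum_principle (R : realType) (I J : finType) (act : J -> I -> I)
    (V : I -> R) (r : J -> I -> R -> R) (d dd : I -> R -> R) :
  (forall p i (t : R), 0 < t -> 0 <= r p i t) ->
  (forall i (t : R), 0 <= t -> is_derive t 1 (d i) (dd i t)) ->
  (forall i, 0 <= d i 0) ->
  (forall i (t : R), 0 < t -> jump_field R I J act V r d i t <= dd i t) ->
  forall i (t : R), 0 <= t -> 0 <= d i t.
Proof.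
move=> r0 hd d0 hdd i0 T T0.
(* With [C] above every [V i], the factor [exp (- C t)] shifts all potentials to strictly negative
   values. *)
pose C : R := 1 + \sum_i `|V i|.
have VC i : V i < C.
  rewrite (le_lt_trans (ler_norm _)) // /C (bigD1 i) //=.
  rewrite addrCA ltrDl ltr_pwDl ?ltr01 //.
  by apply: sumr_ge0.
pose w (t : R) := expR (- C * t).
have w0 t : 0 < w t by exact: expR_gt0.
pose e i t := w t * d i t.
have he i (t : R) : 0 <= t -> is_derive t 1 (e i) (w t * (dd i t - C * d i t)).
  move=> t0; have hdt := hd i t t0.
  have -> : e i = (expR \o (fun t => - C *: t)) * d i by [].
  apply: is_derive_eq.
  by rewrite /w /= /GRing.scale /=; ring.
have minT i : exists2 c, c \in `[0, T]%R & forall t, t \in `[0, T]%R -> e i c <= e i t.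
  apply: EVT_min => //; apply: derivable_within_continuous => t.
  by rewrite in_itv /= => /andP[t0 _]; have [] := he i t t0.
have /choice[c hc] : forall i, exists c, c \in `[0, T]%R /\
    forall t, t \in `[0, T]%R -> e i c <= e i t.
  by move=> i; have [c ? ?] := minT i; exists c.
have [i imin] : exists i, forall j, e i (c i) <= e j (c j).
  case: (@arg_minP _ _ _ i0 xpredT (fun i => e i (c i))) => // i _ imin.
  by exists i => j; exact: imin.
have [cT cmin] := hc i.
have gmin j (t : R) : t \in `[0, T]%R -> e i (c i) <= e j t.
  move=> tT; apply: le_trans (imin j) _; exact: (hc j).2.
suff ei0 : 0 <= e i (c i).
  have : 0 <= e i0 T.
    by apply: le_trans ei0 (gmin _ _ _); rewrite in_itv /= T0 lexx.
  by rewrite pmulr_rge0.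
rewrite leNgt; apply/negP => eneg.
move: (cT); rewrite in_itv /= => /andP[ci0 ciT].
(* A minimum at time 0 would be nonnegative. The differential inequality is available only at
   positive times. *)
have {}ci0 : 0 < c i.
  rewrite lt_neqAle ci0 andbT; apply/eqP => c0.
  by move: eneg; rewrite -c0 ltNge mulr_ge0 // ltW.
have : w (c i) * (dd i (c i) - C * d i (c i)) <= 0.
  apply: (le0_derive_left_min _ (e i) 0 (c i) _ ci0 (he i _ (ltW ci0))).
  move=> t /andP[t0 tc]; apply: cmin.
  by rewrite in_itv /= t0 (le_trans tc).
(* At the negative minimum [dd i >= V i * d i > C * d i], so the derivative of [e i] would be
   positive. *)
apply/negP; rewrite -ltNge pmulr_rgt0 // subr_gt0.
apply: lt_le_trans (hdd _ _ ci0).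
have dneg : d i (c i) < 0 by rewrite -(pmulr_rlt0 _ (w0 (c i))).
rewrite /jump_field ltr_wpDr //; last by rewrite ltr_nM2r.
apply: sumr_ge0 => p _; apply: mulr_ge0; first exact: r0.
by rewrite subr_ge0 -(ler_pM2l (w0 (c i))) gmin.
Qed.

(** Differentiability includes [t = 0], but the equation is imposed only for [t > 0], as the rates
    may be singular at 0. *)
Definition jump_solution (R : realType) (I J : finType) (act : J -> I -> I)
    (V : I -> R) (r : J -> I -> R -> R) (u : I -> R -> R) : Prop :=
  exists2 du : I -> R -> R,
    forall i (t : R), 0 <= t -> is_derive t 1 (u i) (du i t) &
    forall i (t : R), 0 < t -> du i t = jump_field R I J act V r u i t.

Lemma jump_fieldB (R : realType) (I J : finType) (act : J -> I -> I)
    (V : I -> R) (r : J -> I -> R -> R) (u v : I -> R -> R) i t :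
  jump_field R I J act V r (fun i t => u i t - v i t) i t =
  jump_field R I J act V r u i t - jump_field R I J act V r v i t.
Proof.
rewrite /jump_field [RHS](_ : _ = V i * u i t - V i * v i t +
  (\sum_p r p i t * (u (act p i) t - u i t) -
   \sum_p r p i t * (v (act p i) t - v i t))); last by ring.
by rewrite -sumrB mulrBr; congr (_ + _); apply: eq_bigr => p _; ring.
Qed.

Lemma jump_solutionZ (R : realType) (I J : finType) (act : J -> I -> I)
    (V : I -> R) (r : J -> I -> R -> R) (c : R) (u : I -> R -> R) :
  jump_solution R I J act V r u ->
  jump_solution R I J act V r (fun i t => c * u i t).
Proof.
move=> [du hu eu]; exists (fun i t => c * du i t) => i t t0.
  have hut := hu i t t0.
  exact: (@is_deriveZ _ _ _ (u i) c).
rewrite eu // /jump_field mulrDr mulr_sumr; congr (_ + _); first by ring.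
by apply: eq_bigr => p _; ring.
Qed.

Lemma jump_solution_le (R : realType) (I J : finType) (act : J -> I -> I)
    (V : I -> R) (r : J -> I -> R -> R) (u v : I -> R -> R) :
  (forall p i (t : R), 0 < t -> 0 <= r p i t) ->
  jump_solution R I J act V r u -> jump_solution R I J act V r v ->
  (forall i, u i 0 <= v i 0) ->
  forall i (t : R), 0 <= t -> u i t <= v i t.
Proof.
move=> r0 [du hu eu] [dv hv ev] uv0 i t t0; rewrite -subr_ge0.
apply: (jump_minimum_principle R I J act V r (fun i t => v i t - u i t)
  (fun i t => dv i t - du i t)) => // [j s s0|j|j s s0].
- have hus := hu j s s0; have hvs := hv j s s0.
  by apply: (@is_deriveB _ _ _ (v j) (u j)).
- by rewrite subr_ge0.
- by rewrite jump_fieldB eu // ev.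
Qed.

Lemma jump_solution_eq (R : realType) (I J : finType) (act : J -> I -> I)
    (V : I -> R) (r : J -> I -> R -> R) (u v : I -> R -> R) :
  (forall p i (t : R), 0 < t -> 0 <= r p i t) ->
  jump_solution R I J act V r u -> jump_solution R I J act V r v ->
  (forall i, u i 0 = v i 0) ->
  forall i (t : R), 0 <= t -> u i t = v i t.
Proof.
move=> r0 su sv uv0 i t t0; apply/eqP; rewrite eq_le.
by apply/andP; split; apply: (jump_solution_le R I J act V r) => // j; rewrite uv0.
Qed.

(** Strictness comes from comparison with [exp (- K t)]: it does not depend on [i], so its jump
    terms vanish, and [- K <= V i] makes it a subsolution. *)
Lemma jump_solution_gt0 (R : realType) (I J : finType) (act : J -> I -> I)
    (V : I -> R) (r : J -> I -> R -> R) (u : I -> R -> R) :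
  (forall p i (t : R), 0 < t -> 0 <= r p i t) ->
  jump_solution R I J act V r u -> (forall i, u i 0 = 1) ->
  forall i (t : R), 0 <= t -> 0 < u i t.
Proof.
move=> r0 [du hu eu] u0 i t t0.
pose K : R := \sum_i `|V i|.
have VK j : 0 <= V j + K.
  rewrite -lerBlDr sub0r lerNl (le_trans (ler_norm _)) // normrN /K (bigD1 j) //=.
  by rewrite lerDl sumr_ge0.
apply: (@lt_le_trans _ _ (expR (- K * t))); first exact: expR_gt0.
rewrite -subr_ge0.
apply: (jump_minimum_principle R I J act V r (fun i t => u i t - expR (- K * t))
  (fun i t => du i t + K * expR (- K * t))) => // [j s s0|j|j s s0].
- have hus := hu j s s0.
  have -> : (fun t => u j t - expR (- K * t)) = u j - (expR \o (fun t => - K *: t)) by [].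
  apply: is_derive_eq.
  by rewrite /= /GRing.scale /=; ring.
- by rewrite u0 mulr0 expR0 subrr.
- rewrite (jump_fieldB _ _ _ _ _ _ _ (fun i t => expR (- K * t))) eu // lerD2l.
  rewrite /jump_field big1 => [|p _]; last by rewrite subrr mulr0.
  rewrite addr0 -subr_ge0 opprK -mulrDl addrC mulr_ge0 ?expR_ge0 //.
Qed.

(** * Weighted geometric means of solutions *)

(** With [m] the weighted mean of the logarithms, the tangent bound [exp y >= 1 + y] at
    [y = ln c - m] is averaged over [c = a] and [c = b]; the linear terms cancel. *)
Lemma weighted_AMGM (R : realType) (l a b : R) : 0 <= l <= 1 ->
  0 < a -> 0 < b -> expR (l * ln a + (1 - l) * ln b) <= l * a + (1 - l) * b.
Proof.
move=> /andP[l0 l1] a0 b0.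
have H (m c : R) : 0 < c -> expR m * (1 + (ln c - m)) <= c.
  move=> c0; rewrite -{2}(lnK c0) -{2}(subrK m (ln c)) expRD [leRHS]mulrC ler_pM2l ?expR_gt0 //.
  exact: expR_ge1Dx.
set m := l * _ + _; have l1' : 0 <= 1 - l by rewrite subr_ge0.
have := lerD (ler_wpM2l l0 (H m _ a0)) (ler_wpM2l l1' (H m _ b0)).
apply: le_trans; rewrite le_eqVlt; apply/orP; left; apply/eqP.
have -> : l * (expR m * (1 + (ln a - m))) + (1 - l) * (expR m * (1 + (ln b - m))) =
  expR m * (1 + ((l * ln a + (1 - l) * ln b) - m)) by ring.
by rewrite -/m subrr addr0 mulr1.
Qed.

(** For positive [a] and [b] this is [a ^ l * b ^ (1 - l)]. *)
Definition wgeo {R : realType} (l a b : R) : R := expR (l * ln a + (1 - l) * ln b).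

Lemma wgeo_div_le (R : realType) (l a b c d : R) : 0 <= l <= 1 ->
  0 < a -> 0 < b -> 0 < c -> 0 < d ->
  wgeo l a b <= wgeo l c d * (l * (a / c) + (1 - l) * (b / d)).
Proof.
move=> l01 a0 b0 c0 d0.
have := weighted_AMGM R l (a / c) (b / d) l01 (divr_gt0 a0 c0) (divr_gt0 b0 d0).
rewrite -(ler_pM2l (expR_gt0 (l * ln c + (1 - l) * ln d))); apply: le_trans.
rewrite -expRD /wgeo ler_expR !ln_div ?posrE //.
by rewrite le_eqVlt; apply/orP; left; apply/eqP; ring.
Qed.

Lemma wgeoZ (R : realType) (l c a b : R) : 0 < c -> 0 < a -> 0 < b ->
  wgeo l (c * a) (c * b) = c * wgeo l a b.
Proof.
move=> c0 a0 b0; rewrite /wgeo !lnM ?posrE // -[in RHS](lnK c0) -expRD.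
by congr expR; ring.
Qed.

(* A weighted geometric mean of solutions for the potentials [V] and [W] is a
   supersolution for the averaged potential, by the inequality of arithmetic and
   geometric means applied to each jump term. *)
Lemma jump_solution_log_convex (R : realType) (I J : finType) (act : J -> I -> I)
    (V W : I -> R) (r : J -> I -> R -> R) (u v m : I -> R -> R) (l : R) :
  0 <= l <= 1 ->
  (forall p i (t : R), 0 < t -> 0 <= r p i t) ->
  jump_solution R I J act V r u -> jump_solution R I J act W r v ->
  jump_solution R I J act (fun i => l * V i + (1 - l) * W i) r m ->
  (forall i, u i 0 = 1) -> (forall i, v i 0 = 1) -> (forall i, m i 0 = 1) ->
  forall i (t : R), 0 <= t -> m i t <= wgeo l (u i t) (v i t).
Proof.
move=> l01 r0 su sv sm u0 v0 m0 i t t0.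
have up := jump_solution_gt0 _ _ _ _ _ _ _ r0 su u0.
have vp := jump_solution_gt0 _ _ _ _ _ _ _ r0 sv v0.
case: su sv sm => du hu eu [dv hv ev] [dm hm em].
rewrite -subr_ge0.
pose f i (t : R) := wgeo l (u i t) (v i t).
pose df i (t : R) := f i t * (l * (du i t / u i t) + (1 - l) * (dv i t / v i t)).
have f0 j s : 0 < f j s by exact: expR_gt0.
apply: (jump_minimum_principle R I J act (fun i => l * V i + (1 - l) * W i) r
  (fun i t => f i t - m i t)
  (fun i t => df i t - dm i t)) => // [j s s0|j|j s s0].
- have hus := hu j s s0; have hvs := hv j s s0; have hms := hm j s s0.
  have lu := is_derive1_ln (up j s s0); have lv := is_derive1_ln (vp j s s0).
  have -> : (fun t => f j t - m j t) =
     (expR \o (l \*: (@ln R \o u j) + (1 - l) \*: (@ln R \o v j))) - m j by [].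
  apply: is_derive_eq.
  by rewrite /df /f /wgeo /= /GRing.scale /=; ring.
- by rewrite /f /wgeo u0 v0 m0 ln1 !mulr0 addr0 expR0 subrr.
- rewrite jump_fieldB /= em // lerD2r /df eu // ev // /jump_field.
  have un0 : u j s != 0 by rewrite gt_eqF // up // ltW.
  have vn0 : v j s != 0 by rewrite gt_eqF // vp // ltW.
  (* Each [f (act p j) s] is bounded relative to [f j s] by [wgeo_div_le]; the bound so obtained is
     a rearrangement of [df j s]. *)
  rewrite [leRHS](_ : _ = (l * V j + (1 - l) * W j) * f j s +
    \sum_p r p j s * (f j s * (l * (u (act p j) s / u j s) +
        (1 - l) * (v (act p j) s / v j s)) - f j s)).
    rewrite lerD2l; apply: ler_sum => p _; apply: ler_wpM2l; first exact: r0.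
    by rewrite lerD2r wgeo_div_le // ?up ?vp // ltW.
  rewrite ![(V j * _ + _) / _]mulrDl ![(W j * _ + _) / _]mulrDl !mulfK //.
  rewrite !mulr_suml !(mulrDr l) !(mulrDr (1 - l)) addrACA mulrDr !mulr_sumr.
  rewrite -big_split /= mulr_sumr; congr (_ + _); first by ring.
  by apply: eq_bigr => p _; field; apply/andP.
Qed.

(** Hoelder's inequality: relative to the total sums, the termwise bounds of [wgeo_div_le] add up to
    1. The element [i0] makes the sums positive. *)
Lemma wgeo_sum_le (R : realType) (I : finType) (i0 : I) (l : R) (a b : I -> R) :
  0 <= l <= 1 -> (forall i, 0 < a i) -> (forall i, 0 < b i) ->
  \sum_i wgeo l (a i) (b i) <= wgeo l (\sum_i a i) (\sum_i b i).
Proof.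
move=> l01 a0 b0.
have sum_gt0 (c : I -> R) : (forall i, 0 < c i) -> 0 < \sum_i c i.
  by move=> c0; rewrite (bigD1 i0) //= ltr_pwDl // sumr_ge0 // => i _; rewrite ltW.
have A0 := sum_gt0 _ a0; have B0 := sum_gt0 _ b0.
apply: (@le_trans _ _ (\sum_i wgeo l (\sum_i a i) (\sum_i b i) *
   (l * (a i / \sum_i a i) + (1 - l) * (b i / \sum_i b i)))).
  by apply: ler_sum => i _; apply: wgeo_div_le.
rewrite -mulr_sumr big_split /= -!mulr_sumr -!mulr_suml !divff ?gt_eqF //.
by rewrite !mulr1 addrC subrK mulr1.
Qed.

(** * The Cherednik equations along rays *)

Lemma is_derive_ray (R : realType) (n : nat) (f : 'rV[R]_n -> R) (v : 'rV[R]_n) (t : R) :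
  differentiable f (t *: v) -> is_derive t 1 (fun t => f (t *: v)) ('D_v f (t *: v)).
Proof.
move=> /diff_derivable - /(_ v).
have E : (fun h : R => h^-1 *: (((fun t => f (t *: v)) \o shift t) (h *: 1) - f (t *: v)))
  = (fun h : R => h^-1 *: ((f \o shift (t *: v)) (h *: v) - f (t *: v))).
  by apply/funext => h /=; rewrite [h *: 1]mulr1 scalerDl.
by move=> df; apply: DeriveDef; rewrite /derivable /derive E.
Qed.

(** An adjacent transposition permutes the positive roots other than its own simple root, whose sign
    it flips. *)
Lemma sum_pairs_tperm (R : realType) (n : nat) (i j : 'I_n) (F : 'I_n * 'I_n -> R) :
  j = i.+1 :> nat ->
  \sum_(q : 'I_n * 'I_n | (q.1 < q.2)%N) F (tperm i j q.1, tperm i j q.2) =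
  \sum_(q : 'I_n * 'I_n | (q.1 < q.2)%N) F q - F (i, j) + F (j, i).
Proof.
move=> ji.
pose h (q : 'I_n * 'I_n) := (tperm i j q.1, tperm i j q.2).
have hK : involutive h by move=> [a b]; rewrite /h /= !tpermK.
rewrite (reindex_inj (inv_inj hK)) /=.
under eq_bigr do rewrite !tpermK.
rewrite (bigD1 (j, i)) /=; last by rewrite tpermL tpermR ji.
rewrite [in RHS](bigD1 (i, j)) /=; last by rewrite ji.
rewrite [F (i, j) + _]addrC addrK addrC; congr (_ + _).
  apply: eq_big => [[a b]|[a b] _] //=.
  rewrite !xpair_eqE -!val_eqE /=.
  have tpE (c : 'I_n) : tperm i j c =
      (if c == i :> nat then j else if c == j :> nat then i else c) :> nat.
    have [->|->|/eqP ci /eqP cj] := tpermP i j c; rewrite ?eqxx //.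
      by rewrite ji; case: eqP => // ij; rewrite -ij ji.
    by rewrite !val_eqE (negPf ci) (negPf cj).
  rewrite !tpE.
  by case: (eqVneq (a : nat) i) => ai; case: (eqVneq (a : nat) j) => aj;
    case: (eqVneq (b : nat) i) => bi; case: (eqVneq (b : nat) j) => bj /=; lia.
Qed.

(** At [b = 0] division by zero gives the value 0 instead of the limit [1 / t]; in the ray system
    the jump then links two rays through the same point. *)
Definition exp_rate {R : realType} (b t : R) : R := b / (1 - expR (- (t * b))).

Lemma exp_rate_ge0 (R : realType) (b t : R) : 0 < t -> 0 <= exp_rate b t.
Proof.
move=> t0; rewrite /exp_rate; have [b0|b0] := leP 0 b.
  by rewrite divr_ge0 // subr_ge0 -expR0 ler_expR oppr_le0 mulr_ge0 // ltW.
rewrite mulr_le0 ?ltW // invr_lt0 subr_lt0 -expR0 ltr_expR oppr_gt0.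
by rewrite pmulr_rlt0.
Qed.

(** For [y] nonzero, [1 / (1 - exp y) + 1 / (1 - exp (- y)) = 1]. *)
Lemma exp_rateN (R : realType) (b t : R) : 0 < t ->
  exp_rate (- b) t = exp_rate b t - b.
Proof.
move=> t0; rewrite /exp_rate mulrN opprK.
have [->|b0] := eqVneq b 0; first by rewrite oppr0 !mul0r addr0.
have tb : t * b != 0 by rewrite mulf_neq0 // gt_eqF.
have H c : c != 0 -> 1 - expR c != 0 :> R.
  move=> c0; rewrite subr_eq0 -expR0 eq_sym; apply: contra_neq c0.
  exact: expR_inj.
have h1 := H _ tb; have := H (- (t * b)); rewrite oppr_eq0 => /(_ tb) h2.
move: h1 h2; rewrite expRN => h1 h2.
have e0 : expR (t * b) != 0 by rewrite gt_eqF ?expR_gt0.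
have h3 : expR (t * b) - 1 != 0 by rewrite -opprB oppr_eq0.
by field; rewrite h1 h3 e0.
Qed.

(** Products of permutations apply the left factor first, so this swaps positions [q.1] and [q.2] of
    [col_perm sigma x]. *)
Definition perm_jump {n : nat} (q : 'I_n * 'I_n) (sigma : 'S_n) : 'S_n :=
  (tperm q.1 q.2 * sigma)%g.

Definition ray_rate {R : realType} {n : nat} (k : R) (x : 'rV[R]_n)
    (q : 'I_n * 'I_n) (sigma : 'S_n) (t : R) : R :=
  if (q.1 < q.2)%N then k * exp_rate (x ord0 (sigma q.1) - x ord0 (sigma q.2)) t
  else 0.

Definition ray_potential {R : realType} {n : nat} (k : R) (x s : 'rV[R]_n)
    (sigma : 'S_n) : R :=
  dotp s (col_perm sigma x) + k * dotp (rho R n) (col_perm sigma x).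

(* [u sigma t] stands for [G_{k,s} (t sigma x)]: along the ray through
   [sigma x] the Cherednik equation in the direction [sigma x] involves only
   the values on the rays through the [s_ij sigma x]. *)
Definition ray_solution (R : realType) (n : nat) (k : R) (x s : 'rV[R]_n)
    (u : 'S_n -> R -> R) : Prop :=
  jump_solution R 'S_n ('I_n * 'I_n)%type perm_jump (ray_potential k x s)
    (ray_rate k x) u.

Lemma ray_rate_ge0 (R : realType) (n : nat) (k : R) (x : 'rV[R]_n) : 0 <= k ->
  forall q sigma (t : R), 0 < t -> 0 <= ray_rate k x q sigma t.
Proof.
move=> k0 q sigma t t0; rewrite /ray_rate; case: ifP => // _.
by rewrite mulr_ge0 // exp_rate_ge0.
Qed.

Lemma opdam_ray_solution (R : realType) (n : nat) (k : R) (x s : 'rV[R]_n)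
    (g : 'rV[R]_n -> R) :
  is_opdam_G k s g ->
  ray_solution R n k x s (fun sigma t => g (t *: col_perm sigma x)).
Proof.
move=> [smg eqg _].
exists (fun sigma t => 'D_(col_perm sigma x) g (t *: col_perm sigma x)) => sigma t t0.
  by apply: is_derive_ray; have [+ _] := smg 1%N; apply.
have := eqg (col_perm sigma x) (t *: col_perm sigma x).
rewrite /cherednik pair_big_dep /= => /(canRL (subrK _)) /(canRL (addrK _)) ->.
rewrite /jump_field /ray_potential mulrDl; congr (_ + _).
rewrite mulr_sumr -sumrN big_mkcond /=; apply: eq_bigr => -[i j] _.
rewrite /ray_rate /=; case: ifP => _; last by rewrite mul0r.
rewrite /cherednik_quot !mxE.
have -> : xcol i j (t *: col_perm sigma x) = t *: col_perm (perm_jump (i, j) sigma) x.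
  by apply/rowP => l; rewrite !mxE /perm_jump permM.
set a := x _ (sigma i); set b := x _ (sigma j).
rewrite (inj_eq (mulfI (lt0r_neq0 t0))).
(* On the wall [a = b] both sides vanish: the Cherednik term through its factor [a - b], the jump
   term through its rate. *)
case: (eqVneq a b) => [->|ab]; first by rewrite subrr /exp_rate !mul0r mulr0 oppr0 mul0r.
rewrite /exp_rate -mulrBr.
by ring.
Qed.

(** * Adjacent transpositions acting on the ray system *)

Lemma dotp_rho (R : realType) (n : nat) (v : 'rV[R]_n) :
  dotp (rho R n) v =
  2^-1 * \sum_(q : 'I_n * 'I_n | (q.1 < q.2)%N) (v ord0 q.1 - v ord0 q.2).
Proof.
have rhoE i : rho R n ord0 i = 2^-1 * \sum_(q : 'I_n * 'I_n | (q.1 < q.2)%N)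
    ((i == q.1)%:R - (i == q.2)%:R).
  rewrite /rho pair_big_dep mxE summxE; congr (_ * _).
  by apply: eq_bigr => q _; rewrite !mxE.
rewrite /dotp; under eq_bigr do rewrite rhoE -mulrA mulr_suml.
rewrite -mulr_sumr; congr (_ * _).
rewrite exchange_big /=; apply: eq_bigr => -[a b] _ /=.
under eq_bigr do rewrite mulrBl.
rewrite sumrB (bigD1 a) //= (bigD1 (P := fun _ => true) b) //= !eqxx !mul1r !big1 ?addr0 //.
  by move=> i /negPf ->; rewrite mul0r.
by move=> i /negPf ->; rewrite mul0r.
Qed.

Lemma dotp_xcol (R : realType) (n : nat) (i j : 'I_n) (s v : 'rV[R]_n) :
  dotp (xcol i j s) v = dotp s (xcol i j v).
Proof.
rewrite /dotp (reindex_inj (@perm_inj _ (tperm i j))) /=.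
by apply: eq_bigr => l _; rewrite !mxE tpermK.
Qed.

Lemma dotpB_xcol (R : realType) (n : nat) (i j : 'I_n) (s v : 'rV[R]_n) :
  i != j ->
  dotp s v - dotp s (xcol i j v) =
  (s ord0 i - s ord0 j) * (v ord0 i - v ord0 j).
Proof.
move=> ij; have ji : j != i by rewrite eq_sym.
rewrite /dotp -sumrB (bigD1 i) //= (bigD1 j) //= big1 => [|l /andP[li lj]].
  by rewrite !mxE tpermL tpermR; ring.
by rewrite !mxE tpermD ?subrr // eq_sym.
Qed.

(** A simple reflection sends [rho] to [rho] minus its simple root, the only positive root made
    negative. *)
Lemma dotp_rho_xcol (R : realType) (n : nat) (i j : 'I_n) (v : 'rV[R]_n) :
  j = i.+1 :> nat ->
  dotp (rho R n) (xcol i j v) = dotp (rho R n) v - (v ord0 i - v ord0 j).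
Proof.
move=> ji; rewrite !dotp_rho.
under eq_bigr do rewrite !mxE.
rewrite (sum_pairs_tperm R n i j (fun q => v ord0 q.1 - v ord0 q.2)) //=.
by field.
Qed.

Lemma ray_potential_tperm (R : realType) (n : nat) (k : R) (x s : 'rV[R]_n)
    (i j : 'I_n) (sigma : 'S_n) : j = i.+1 :> nat ->
  ray_potential k x s (tperm i j * sigma)%g =
  ray_potential k x (xcol i j s) sigma
  - k * (x ord0 (sigma i) - x ord0 (sigma j)).
Proof.
move=> ji; rewrite /ray_potential.
have -> : col_perm (tperm i j * sigma)%g x = xcol i j (col_perm sigma x).
  by apply/rowP => l; rewrite !mxE permM.
by rewrite dotp_xcol dotp_rho_xcol // !mxE; ring.
Qed.

(* The rank-one relation [s_i T_xi s_i = T_(s_i xi) - k <alpha_i, xi> s_i] of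
   the graded Hecke algebra, read along rays. *)
Lemma ray_solution_tperm (R : realType) (n : nat) (k c : R) (x s : 'rV[R]_n)
    (i j : 'I_n) (u : 'S_n -> R -> R) : j = i.+1 :> nat ->
  c * (s ord0 i - s ord0 j) = k ->
  ray_solution R n k x s u ->
  ray_solution R n k x (xcol i j s)
    (fun sigma t => u (tperm i j * sigma)%g t + c * u sigma t).
Proof.
move=> ji ck [du hu eu].
exists (fun sigma t => du (tperm i j * sigma)%g t + c * du sigma t) => sigma t t0.
  have h1 := hu (tperm i j * sigma)%g t t0; have h2 := hu sigma t t0.
  have -> : (fun t => u (tperm i j * sigma)%g t + c * u sigma t) =
    u (tperm i j * sigma)%g + c \*: u sigma by [].
  exact: is_derive_eq.
rewrite !eu // /jump_field ray_potential_tperm //.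
pose b := x ord0 (sigma i) - x ord0 (sigma j).
pose v tau := u (tperm i j * tau)%g t.
pose F (q : 'I_n * 'I_n) := k * exp_rate (x ord0 (sigma q.1) - x ord0 (sigma q.2)) t *
  (v (perm_jump q sigma) - v sigma).
(* Conjugation by [tperm i j] relabels the jumps. Only the pair [(i, j)] changes sign, and
   [exp_rateN] turns this into the extra term with factor [k * b]. *)
have reflected_jumps : \sum_p ray_rate k x p (tperm i j * sigma)%g t *
    (u (perm_jump p (tperm i j * sigma)%g) t - u (tperm i j * sigma)%g t) =
  \sum_p ray_rate k x p sigma t * (v (perm_jump p sigma) - v sigma)
  + k * b * (u (tperm i j * sigma)%g t - u sigma t).
  transitivity (\sum_(q : 'I_n * 'I_n | (q.1 < q.2)%N) F (tperm i j q.1, tperm i j q.2)).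
    rewrite [RHS]big_mkcond /=; apply: eq_bigr => -[l m] _.
    rewrite /ray_rate /=; case: ifP => _; last by rewrite mul0r.
    rewrite /F /v /= /perm_jump /= !permM; congr (_ * (u _ t - _)).
    rewrite !mulgA; congr (_ * _)%g.
    by rewrite -(tpermJ l m (tperm i j)) conjgE tpermV !mulgA tperm2 mul1g.
  rewrite sum_pairs_tperm // -addrA; congr (_ + _).
    rewrite big_mkcond /=; apply: eq_bigr => q _.
    by rewrite /ray_rate; case: ifP => _; rewrite ?mul0r.
  rewrite /F /= -/b -[x _ (sigma j) - _]opprB -/b exp_rateN //.
  rewrite /perm_jump /= (tpermC j i) /v mulgA tperm2 mul1g.
  by ring.
rewrite reflected_jumps.
have -> : ray_potential k x s sigma = ray_potential k x (xcol i j s) sigma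
    + (s ord0 i - s ord0 j) * b.
  have ij : i != j by rewrite -val_eqE /= ji neq_ltn ltnSn.
  rewrite /ray_potential dotp_xcol addrAC; congr (_ + _).
  have := dotpB_xcol R n i j s (col_perm sigma x) ij.
  by rewrite !mxE => <-; rewrite addrC subrK.
rewrite [in RHS](eq_bigr (fun p => ray_rate k x p sigma t * (v (perm_jump p sigma) - v sigma)
  + c * (ray_rate k x p sigma t * (u (perm_jump p sigma) t - u sigma t)))); last first.
  by move=> p _; rewrite /v; ring.
(* The extra terms in [k * b] cancel against the two changes of potential because
   [c * (s_i - s_j) = k]. *)
rewrite big_split /= -mulr_sumr -ck /v -/b.
by ring.
Qed.

(** * Majorization *)

(** Adjacent transpositions generate the symmetric group: conjugating by one of them lengthens a
    transposition by one step. *)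
Lemma sym_adjacent_tperm (R : realType) (n : nat) (f : 'rV[R]_n -> R) :
  (forall (i j : 'I_n) s, j = i.+1 :> nat -> f (xcol i j s) = f s) ->
  forall (tau : 'S_n) s, f (col_perm tau s) = f s.
Proof.
move=> fadj.
have colM (a b : 'S_n) (s : 'rV[R]_n) : col_perm (a * b)%g s = col_perm a (col_perm b s).
  by apply/rowP => l; rewrite !mxE permM.
have ftp (d : nat) : forall (i j : 'I_n) s, j = (i + d.+1)%N :> nat ->
    f (col_perm (tperm i j) s) = f s.
  elim: d => [|d IHd] i j s ji; first by apply: fadj; rewrite ji addn1.
  have jn : (i + d.+1 < n)%N by rewrite (leq_ltn_trans _ (ltn_ord j)) // ji leq_add2l.
  pose j' := Ordinal jn.
  have jj' : j = j'.+1 :> nat by rewrite ji /= addnS.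
  have <- : (tperm i j' ^ tperm j' j)%g = tperm i j.
    rewrite tpermJ tpermL tpermD // -val_eqE /=; lia.
  rewrite conjgE tpermV !colM.
  by rewrite (fadj j' j) // IHd // (fadj j' j).
move=> tau; have [ts -> /allP dts] := prod_tpermP tau.
elim: ts dts => [|[i j] ts IHts] dts s.
  by rewrite big_nil col_perm1.
have /= ij : i != j by apply: (dts (i, j)); rewrite mem_head.
rewrite big_cons colM /=.
have -> u : f (col_perm (tperm i j) u) = f u.
  have [lij|lji|/val_inj eij] := ltngtP i j; last by rewrite eij eqxx in ij.
    by apply: (ftp (j - i).-1); lia.
  by rewrite tpermC; apply: (ftp (i - j).-1); lia.
by apply: IHts => p pts; apply: dts; rewrite inE pts orbT.
Qed.

Lemma decr_perm (R : realType) (n : nat) (x : 'rV[R]_n) :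
  exists tau : 'S_n, decr x = col_perm tau x.
Proof.
pose t := [tuple x ord0 j | j < n].
have : perm_eq (sort >=%R [seq x ord0 j | j <- enum 'I_n]) t.
  by rewrite perm_sort /t /= enumT.
move=> /tuple_permP[tau eq_sort]; exists tau; apply/rowP => i.
by rewrite !mxE eq_sort nth_mktuple tnth_mktuple.
Qed.

Lemma decr_le (R : realType) (n : nat) (x : 'rV[R]_n) (i j : 'I_n) :
  (i <= j)%N -> decr x ord0 j <= decr x ord0 i.
Proof.
move=> ij; rewrite !mxE.
have := @sorted_leq_nth _ >=%R ge_trans ge_refl 0 (sort >=%R [seq x ord0 j | j <- enum 'I_n]).
apply => //; rewrite ?sort_sorted //; first exact: ge_total.
- by rewrite inE size_sort size_map size_enum_ord.
- by rewrite inE size_sort size_map size_enum_ord.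
Qed.

(* Each step replaces [x] by a convex combination of [x] and one of its
   transpositions which agrees with [y] in at least one more coordinate. *)
Lemma le_of_prefix_sums (R : realType) (n : nat) (f : 'rV[R]_n -> R) (y : 'rV[R]_n) :
  (forall (tau : 'S_n) s, f (col_perm tau s) = f s) ->
  (forall (l : R) s t, 0 <= l <= 1 -> f s = f t -> f (l *: s + (1 - l) *: t) <= f s) ->
  (forall i j : 'I_n, (i <= j)%N -> y ord0 j <= y ord0 i) ->
  forall x : 'rV[R]_n, \sum_i x ord0 i = \sum_i y ord0 i ->
  (forall r, \sum_(i < n | (i < r)%N) y ord0 i <= \sum_(i < n | (i < r)%N) x ord0 i) ->
  f y <= f x.
Proof.
move=> fsym fqc ydecr x.
(* Induction on the number of coordinates where [x] and [y] differ. *)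
have [m] := ubnP #|[pred i | x ord0 i != y ord0 i]|.
elim: m x => // m IHm x; rewrite ltnS => xm sum_eq prefix.
have [exk|nlt] := pselect (exists k : 'I_n, x ord0 k < y ord0 k); last first.
  have le_yx i : y ord0 i <= x ord0 i.
    by rewrite leNgt; apply/negP => lt_xy; apply: nlt; exists i.
  have /eqP : \sum_i (x ord0 i - y ord0 i) = 0 by rewrite sumrB sum_eq subrr.
  rewrite psumr_eq0 => [/allP x_eq_y|i _]; last by rewrite subr_ge0.
  suff -> : x = y by [].
  apply/rowP => i; apply/eqP; rewrite -subr_eq0.
  by apply: (implyP (x_eq_y i _)) => //; rewrite mem_index_enum.
have [k xyk kmin] : exists2 k : 'I_n, x ord0 k < y ord0 k &
    forall l : 'I_n, (l < k)%N -> y ord0 l <= x ord0 l.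
  have [k0 xyk0] := exk.
  case: (@arg_minnP _ k0 (fun k => x ord0 k < y ord0 k) val xyk0) => k xyk kmin.
  exists k => // l lk; rewrite leNgt; apply/negP => /kmin /=.
  by rewrite leqNgt lk.
(* Otherwise the prefix sum of [x] through index [k] would be smaller than that of [y]. *)
have [j jk xyj] : exists2 j : 'I_n, (j < k)%N & y ord0 j < x ord0 j.
  case: (pickP (fun j : 'I_n => (j < k)%N && (y ord0 j < x ord0 j))) =>
    [j /andP[jk xyj]|nex]; first by exists j.
  exfalso.
  have := prefix k.+1; apply/negP; rewrite -ltNge.
  rewrite (bigD1 k) //= [ltRHS](bigD1 k) //=.
  apply: ltr_leD => //; apply: ler_sum => l /andP[lk lnk].
  have {}lk : (l < k)%N by rewrite ltn_neqAle val_eqE lnk -ltnS.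
  by have := nex l; rewrite lk /= ltNge => /negbFE.
have yjk : y ord0 k <= y ord0 j by apply: ydecr; rewrite ltnW.
(* The largest amount that can move from coordinate [j] to coordinate [k] without overshooting [y]
   in either; [th] below is the weight that moves exactly [d]. *)
pose d := Num.min (x ord0 j - y ord0 j) (y ord0 k - x ord0 k).
have d1 : d <= x ord0 j - y ord0 j by rewrite ge_min lexx.
have d2 : d <= y ord0 k - x ord0 k by rewrite ge_min lexx orbT.
have d0 : 0 < d by rewrite lt_min !subr_gt0 xyj.
have D0 : 0 < x ord0 j - x ord0 k by lra.
pose th := d / (x ord0 j - x ord0 k).
have th01 : 0 <= th <= 1.
  apply/andP; split; first by apply: divr_ge0; apply: ltW.
  by rewrite ler_pdivrMr // mul1r; lra.
pose x' := th *: xcol j k x + (1 - th) *: x.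
have jnk : j != k by rewrite -val_eqE neq_ltn jk.
have xj' : x' ord0 j = x ord0 j - d.
  by rewrite !mxE tpermL /th; field; lra.
have xk' : x' ord0 k = x ord0 k + d.
  by rewrite !mxE tpermR /th; field; lra.
have xl' l : l != j -> l != k -> x' ord0 l = x ord0 l.
  move=> lj lk; rewrite !mxE tpermD 1?eq_sym //; ring.
have sum' (P : pred 'I_n) : \sum_(i | P i) x' ord0 i =
    \sum_(i | P i) x ord0 i - (P j)%:R * d + (P k)%:R * d.
  rewrite ![\sum_(i | P i) _]big_mkcond /=.
  rewrite (bigD1 j) //= (bigD1 k) 1?eq_sym //= [in RHS](bigD1 j) //= [in RHS](bigD1 k) 1?eq_sym //=.
  rewrite (eq_bigr (fun i => if P i then x ord0 i else 0)) => [|l /andP[lj lk]]; last first.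
    by rewrite xl'.
  by rewrite xj' xk'; case: (P j); case: (P k) => /=; ring.
apply: (@le_trans _ _ (f x')); last first.
  rewrite -[leRHS](fsym (tperm j k)); apply: fqc => //; exact: fsym.
apply: IHm.
- apply: leq_trans xm; apply: proper_card; apply/properP; split.
    apply/fintype.subsetP => l; rewrite !inE.
    have [-> _|lj] := eqVneq l j; first by rewrite gt_eqF.
    have [-> _|lk] := eqVneq l k; first by rewrite lt_eqF.
    by rewrite xl'.
  have [dj|dk] : d = x ord0 j - y ord0 j \/ d = y ord0 k - x ord0 k.
    by rewrite /d; case: leP; [left|right].
  + exists j; rewrite !inE; first by rewrite gt_eqF.
    by rewrite xj' dj subKr eqxx.
  + exists k; rewrite !inE; first by rewrite lt_eqF.
    by rewrite xk' dk addrC subrK eqxx.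
- by rewrite sum' /= mul1r subrK.
(* The prefix sum changes only for [j < r <= k], where it loses [d]; there [x'] still dominates [y]
   term by term. *)
- move=> r; rewrite sum'.
  have [rk|kr] := leqP r k; last first.
    by rewrite (ltn_trans jk kr) /= !mul1r subrK.
  rewrite [(0%:R)](_ : _ = 0) // mul0r addr0.
  have [jr|rj] := ltnP j r; last by rewrite mul0r subr0.
  rewrite mul1r (bigD1 j) //= [in leRHS](bigD1 j) //=.
  have : \sum_(i < n | (i < r)%N && (i != j)) y ord0 i <=
     \sum_(i < n | (i < r)%N && (i != j)) x ord0 i.
    by apply: ler_sum => l /andP[lr _]; apply: kmin; apply: leq_trans lr rk.
  by lra.
Qed.

(** By symmetry both vectors may be sorted. Quasiconvexity is asked only at equal values, as between
    a vector and its transposition. *)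
Lemma schur_convex_sym_quasiconvex (R : realType) (n : nat) (f : 'rV[R]_n -> R) :
  (forall (tau : 'S_n) s, f (col_perm tau s) = f s) ->
  (forall (l : R) s t, 0 <= l <= 1 -> f s = f t -> f (l *: s + (1 - l) *: t) <= f s) ->
  schur_convex f.
Proof.
move=> fsym fqc x y [sum_eq prefix].
have fdecr z : f (decr z) = f z by have [tau ->] := decr_perm R n z; exact: fsym.
have sum_decr (z : 'rV[R]_n) : \sum_i decr z ord0 i = \sum_i z ord0 i.
  have [tau ->] := decr_perm R n z.
  rewrite [RHS](reindex_inj (@perm_inj _ tau)) /=.
  by apply: eq_bigr => i _; rewrite mxE.
rewrite -fdecr -[leRHS]fdecr; apply: le_of_prefix_sums => //.
- by move=> i j; exact: decr_le.
- by rewrite !sum_decr.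
(* Majorization speaks of [1 <= r < n]; larger [r] give the total sums, and [r = 0] gives empty
   ones. *)
- move=> r; have [rn|nr] := ltnP r n; last first.
    have all_lt (i : 'I_n) : (i < r)%N = true by rewrite (leq_trans (ltn_ord i)).
    rewrite !(eq_bigl _ _ all_lt) !sum_decr sum_eq //.
  case: r rn => [|r] rn; first by rewrite !big_pred0.
  exact: prefix.
Qed.

(** * Log-convexity and symmetry of [F_{k,s}(x)] in [s] *)

Lemma symmetrize_ray (R : realType) (n : nat) (g : 'rV[R]_n -> R) (x : 'rV[R]_n) :
  symmetrize g x = (n`!)%:R^-1 * \sum_(sigma : 'S_n) g (1 *: col_perm sigma x).
Proof. by rewrite /symmetrize; under [in RHS]eq_bigr do rewrite scale1r. Qed.

Lemma opdam_ray0 (R : realType) (n : nat) (k : R) (s x : 'rV[R]_n) (g : 'rV[R]_n -> R) :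
  is_opdam_G k s g -> forall sigma : 'S_n, g (0 *: col_perm sigma x) = 1.
Proof. by move=> [_ _ g0] sigma; rewrite scale0r. Qed.

Lemma symmetrize_opdam_gt0 (R : realType) (n : nat) (k : R) (s x : 'rV[R]_n)
    (g : 'rV[R]_n -> R) :
  0 <= k -> is_opdam_G k s g -> 0 < symmetrize g x.
Proof.
move=> k0 hg; rewrite symmetrize_ray mulr_gt0 ?invr_gt0 ?ltr0n ?fact_gt0 //.
have pos sigma := jump_solution_gt0 _ _ _ _ _ _ _ (ray_rate_ge0 R n k x k0)
  (opdam_ray_solution R n k x s g hg) (opdam_ray0 _ _ _ _ _ _ hg) sigma 1 ler01.
rewrite (bigD1 1%g) //= ltr_pwDl //.
by apply: sumr_ge0 => sigma _; apply: ltW; exact: pos.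
Qed.

(** The potential is affine in [s], so log-convexity holds on each ray at time 1; Hoelder's
    inequality sums it over the rays. *)
Lemma symmetrize_opdam_log_convex (R : realType) (n : nat) (k l : R)
    (s s' x : 'rV[R]_n) (g g' h : 'rV[R]_n -> R) :
  0 <= k -> 0 <= l <= 1 -> is_opdam_G k s g -> is_opdam_G k s' g' ->
  is_opdam_G k (l *: s + (1 - l) *: s') h ->
  symmetrize h x <= wgeo l (symmetrize g x) (symmetrize g' x).
Proof.
move=> k0 l01 hg hg' hh; rewrite !symmetrize_ray.
have r0 := ray_rate_ge0 R n k x k0.
have sg := opdam_ray_solution R n k x s g hg.
have sg' := opdam_ray_solution R n k x s' g' hg'.
have ig := opdam_ray0 R n k s x g hg.
have ig' := opdam_ray0 R n k s' x g' hg'.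
have pg sigma := jump_solution_gt0 _ _ _ _ _ _ _ r0 sg ig sigma 1 ler01.
have pg' sigma := jump_solution_gt0 _ _ _ _ _ _ _ r0 sg' ig' sigma 1 ler01.
have sum_gt0 (c : 'S_n -> R) : (forall i, 0 < c i) -> 0 < \sum_i c i.
  by move=> c0; rewrite (bigD1 1%g) //= ltr_pwDl // sumr_ge0 // => i _; rewrite ltW.
have n0 : 0 < (n`!)%:R^-1 :> R by rewrite invr_gt0 ltr0n fact_gt0.
rewrite wgeoZ ?sum_gt0 // ler_pM2l //.
apply: le_trans (wgeo_sum_le _ _ 1%g l _ _ l01 pg pg').
apply: ler_sum => sigma _.
apply: (jump_solution_log_convex _ _ _ _ _ _ _ _ _
  (fun sigma t => h (t *: col_perm sigma x)) l l01 r0 sg sg' _ ig ig' _ sigma 1 ler01).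
  have := opdam_ray_solution R n k x _ h hh; rewrite /ray_solution.
  have -> // : ray_potential k x (l *: s + (1 - l) *: s') =
    (fun i => l * ray_potential k x s i + (1 - l) * ray_potential k x s' i).
  apply/funext => tau; rewrite /ray_potential.
  have -> v : dotp (l *: s + (1 - l) *: s') v = l * dotp s v + (1 - l) * dotp s' v.
    rewrite /dotp !mulr_sumr -big_split.
    by apply: eq_bigr => i _ /=; rewrite !mxE; ring.
  by ring.
exact: opdam_ray0 hh.
Qed.

(** Both solutions for [xcol i j s] start at [1 + c], hence agree. Summing over the group turns the
    identity into [1 + c] times the claim. *)
Lemma symmetrize_opdam_xcol (R : realType) (n : nat) (k : R) (s x : 'rV[R]_n)
    (G : 'rV[R]_n -> 'rV[R]_n -> R) (i j : 'I_n) :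
  0 <= k -> (forall s, is_opdam_G k s (G s)) -> j = i.+1 :> nat ->
  symmetrize (G (xcol i j s)) x = symmetrize (G s) x.
Proof.
move=> k0 hG ji.
have xcolK (v : 'rV[R]_n) : xcol i j (xcol i j v) = v.
  by apply/rowP => l; rewrite !mxE tpermK.
(* This order of the coordinates makes [c >= 0], so that [1 + c] can be cancelled; exchanging [s]
   and [xcol i j s] covers the other order. *)
have gt_case (v : 'rV[R]_n) : v ord0 j < v ord0 i ->
    symmetrize (G (xcol i j v)) x = symmetrize (G v) x.
  rewrite -subr_gt0 => b0; rewrite !symmetrize_ray; congr (_ * _).
  pose c := k / (v ord0 i - v ord0 j).
  have c0 : 0 < 1 + c by rewrite ltr_pwDl // divr_ge0 // ltW.
  have sv := ray_solution_tperm R n k c x v i j _ ji (divfK (lt0r_neq0 b0) k)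
    (opdam_ray_solution R n k x v _ (hG v)).
  have sv' := jump_solutionZ _ _ _ _ _ _ (1 + c) _
    (opdam_ray_solution R n k x _ _ (hG (xcol i j v))).
  have E := jump_solution_eq _ _ _ _ _ _ _ _ (ray_rate_ge0 R n k x k0) sv sv'.
  have {}E sigma : G v (1 *: col_perm (tperm i j * sigma)%g x) +
      c * G v (1 *: col_perm sigma x) = (1 + c) * G (xcol i j v) (1 *: col_perm sigma x).
    by apply: E ler01 => tau; rewrite !(opdam_ray0 _ _ _ _ _ _ (hG _)) !mulr1.
  apply: (mulfI (lt0r_neq0 c0)); rewrite mulr_sumr.
  under eq_bigr do rewrite -E.
  rewrite big_split /= -mulr_sumr mulrDl mul1r; congr (_ + _).
  by rewrite [RHS](reindex_inj (mulgI (tperm i j))).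
have [lt|lt|eq] := ltgtP (s ord0 j) (s ord0 i); first exact: gt_case.
  by rewrite -(gt_case (xcol i j s)) ?xcolK // !mxE tpermL tpermR.
congr (symmetrize (G _) x); apply/rowP => l; rewrite !mxE.
by case: tpermP => [->|->|].
Qed.

Theorem theorem2p6 (R : realType) (n : nat) (k : R) (hk : 0 <= k)
    (G : 'rV[R]_n -> 'rV[R]_n -> R)
    (hG : forall s : 'rV[R]_n, is_opdam_G k s (G s))
    (x : 'rV[R]_n) :
  let F := fun s : 'rV[R]_n => symmetrize (G s) x in
  [/\ forall s, 0 < F s, log_convex F & schur_convex F].
Proof.
move=> F.
have F0 s : 0 < F s by exact: symmetrize_opdam_gt0 (hG s).
have Fconv (l : R) s t : 0 <= l <= 1 -> F (l *: s + (1 - l) *: t) <= wgeo l (F s) (F t).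
  by move=> l01; apply: (symmetrize_opdam_log_convex _ _ k _ s t).
split=> //.
- split=> // l s t _ _.
  rewrite -ler_expR lnK; last by rewrite posrE F0.
  by apply: Fconv; rewrite ge0 le1.
- apply: schur_convex_sym_quasiconvex => [|l s t l01 Fst].
    apply: sym_adjacent_tperm => i j s ji.
    exact: symmetrize_opdam_xcol hG ji.
  (* When [F s = F t], their weighted geometric mean is [F s] itself. *)
  apply: le_trans (Fconv _ _ _ l01) _.
  by rewrite /wgeo -Fst -mulrDl addrC subrK mul1r lnK ?posrE.
Qed.
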